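(* Suppose that the convex operator $\rho(\cdot)$ is stable and proper. Let $\xi\in L^{4p}_{\mathcal{F}}(\mathbb{P})$ be given and let $\mathcal{C}$ be a sub $\sigma$-algebra of $\mathcal{F}$. Then the optimal solution of the problem of finding $\hat\eta\in L^{2p}_{\mathcal{C}}(\mathbb{P})$ with $$\rho\big((\xi-\hat\eta)^2\big)=\inf_{\eta\in L^{2p}_{\mathcal{C}}(\mathbb{P})}\rho\big((\xi-\eta)^2\big)$$ is unique ($\mathbb{P}$-a.s.).
   Context: $(\Omega,\mathcal{F},\mathbb{P})$ is a probability space, $1<p\le2$, $\frac1p+\frac1q=1$. For a sub $\sigma$-algebra $\mathcal{G}$ of $\mathcal{F}$, $L^r_{\mathcal{G}}(\mathbb{P})$ is the set of $r$-th power $\mathbb{P}$-integrable $\mathcal{G}$-measurable random variables. $\mathcal{M}$ is the set of probability measures absolutely continuous with respect to $\mathbb{P}$; for $P\in\mathcal{M}$, $f^P=dP/d\mathbb{P}$, and $f^P_{\mathcal{C}}=\mathbb{E}[f^P|\mathcal{C}]$ ($\mathbb{E}$ is expectation under $\mathbb{P}$, $E_P$ under $P$). A convex operator is a map $\rho:L^p_{\mathcal{F}}(\mathbb{P})\to\mathbb{R}$ that is monotone ($\xi_1\ge\xi_2$ implies $\rho(\xi_1)\ge\rho(\xi_2)$), constant invariant ($\rho(\xi+c)=\rho(\xi)+c$ for $c\in\mathbb{R}$) and convex; throughout it is normalized: $\rho(0)=0$. Put $\mathcal{A}_\rho=\{\zeta\in L^p_{\mathcal{F}}(\mathbb{P}):\rho(\zeta)\le0\}$,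 $\alpha(P)=\sup_{\zeta\in\mathcal{A}_\rho}E_P[\zeta]$, and the representation set $\mathcal{P}=\{P\in\mathcal{M}: f^P\in L^q_{\mathcal{F}}(\mathbb{P}),\ \alpha(P)<\infty\}$; $\mathcal{D}=\{f^P:P\in\mathcal{P}\}$. The following facts, quoted in the paper from the literature, are standing: $\rho(\xi)=\sup_{P\in\mathcal{P}}[E_P[\xi]-\alpha(P)]$ for all $\xi\in L^p_{\mathcal{F}}(\mathbb{P})$; $\mathcal{D}$ is norm-bounded in $L^q_{\mathcal{F}}(\mathbb{P})$ and $\sigma(L^q_{\mathcal{F}}(\mathbb{P}),L^p_{\mathcal{F}}(\mathbb{P}))$-compact; $\mathcal{P}$ is convex. $\rho$ is stable if for every $P\in\mathcal{P}$ and every sub $\sigma$-algebra $\mathcal{C}$ of $\mathcal{F}$, $f^P/f^P_{\mathcal{C}}\in\mathcal{D}$. $\rho$ is proper if every element of $\mathcal{P}$ is equivalent to $\mathbb{P}$. *)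

(* Defs.v *)
From HB Require Import structures.
From mathcomp Require Import all_boot all_order all_algebra.
From mathcomp Require Import all_classical all_reals all_analysis.

Set Implicit Arguments.
Unset Strict Implicit.
Unset Printing Implicit Defensive.

Import Order.TTheory GRing.Theory Num.Theory.
Import numFieldNormedType.Exports.

Local Open Scope classical_set_scope.
Local Open Scope ring_scope.

(* Random variables are genuine functions T -> R; elements of L^r(P) are the
   members of [Lfun P r%:E], and identities between them hold P-a.e.  *)

Section sub_sigma_algebras.
Context {d : measure_display} {T : measurableType d} {R : realType}.
Implicit Types (P : probability T R) (C : set (set T)).

Definition is_sub_sigma_algebra C : Prop :=
  sigma_algebra [set: T] C /\ C `<=` @measurable d T.

Definition measurable_wrt C (f : T -> R) : Prop :=
  measurable_fun [set: g_sigma_algebraType C]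
    (f : g_sigma_algebraType C -> R).

Definition LfunC P C (r : R) : set (T -> R) :=
  [set f | f \in Lfun P r%:E /\ measurable_wrt C f].

(* [g] is a version of E[f | C] *)
Definition is_cond_exp P C (f g : T -> R) : Prop :=
  [/\ measurable_wrt C g, g \in Lfun P 1%E &
      forall A, C A ->
        (\int[P]_(w in A) (g w)%:E = \int[P]_(w in A) (f w)%:E)%E].

End sub_sigma_algebras.

Section convex_operators.
Context {d : measure_display} {T : measurableType d} {R : realType}.
Variables (P : probability T R) (p q : R).
Implicit Types (Q : probability T R) (xi zeta f : T -> R).

(* The values of [rho] outside L^p(P) are irrelevant.  By monotonicity with
   respect to the a.e. order, [rho] only depends on a.e.-classes. *)
Record convex_operator (rho : (T -> R) -> R) : Prop := {
  co_monotone : forall xi1 xi2, xi1 \in Lfun P p%:E -> xi2 \in Lfun P p%:E ->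
    {ae P, forall w, xi2 w <= xi1 w} -> rho xi2 <= rho xi1 ;
  co_constant : forall xi (c : R), xi \in Lfun P p%:E ->
    rho (fun w => xi w + c) = rho xi + c ;
  co_convex : forall xi1 xi2 (t : R),
    xi1 \in Lfun P p%:E -> xi2 \in Lfun P p%:E -> 0 <= t <= 1 ->
    rho (fun w => t * xi1 w + (1 - t) * xi2 w) <=
      t * rho xi1 + (1 - t) * rho xi2 ;
  co_normalized : rho (fun=> 0) = 0 }.

Definition density Q : T -> R :=
  fun w => fine (Radon_Nikodym (charge_of_finite_measure Q) P w).

Variable rho : (T -> R) -> R.

Definition acceptance_set : set (T -> R) :=
  [set zeta | zeta \in Lfun P p%:E /\ rho zeta <= 0].

Definition penalty Q : \bar R :=
  ereal_sup [set ('E_Q[zeta])%E | zeta in acceptance_set].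

Definition representation_set : set (probability T R) :=
  [set Q : probability T R |
    [/\ Q `<< P, density Q \in Lfun P q%:E & (penalty Q < +oo)%E]].

(* all measurable versions of the densities of the representation set *)
Definition density_set : set (T -> R) :=
  [set f | f \in Lfun P q%:E /\
    exists2 Q, representation_set Q & f = density Q %[ae P]].

(* sigma(L^q, L^p) is the initial topology of f |-> (xi |-> E[f xi]); as
   L^q is not quotiented here, it does not separate a.e.-equal functions,
   which is immaterial for compactness of [density_set]. *)
Definition duality_pairing (h : {f : T -> R | f \in Lfun P q%:E}) :
    {ptws {z : T -> R | z \in Lfun P p%:E} -> R} :=
  fun z => fine ('E_P[(sval h \* sval z)%R])%E.

Definition density_set_weak_compact : Prop :=
  compact ([set h | density_set (sval h)] :
    set (initial_topology duality_pairing)).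

Definition density_set_bounded : Prop :=
  exists M : R, forall f, density_set f ->
    ('N[P]_q%:E [EFin \o f] <= M%:E)%E.

Definition representation_set_convex : Prop :=
  forall Q1 Q2 (t : R), representation_set Q1 -> representation_set Q2 ->
    0 <= t <= 1 ->
    exists2 Q, representation_set Q &
      forall A, measurable A ->
        (Q A = t%:E * Q1 A + (1 - t)%:E * Q2 A)%E.

Definition dual_representation : Prop :=
  forall xi, xi \in Lfun P p%:E ->
    ((rho xi)%:E =
      ereal_sup [set 'E_Q[xi] - penalty Q | Q in representation_set])%E.

Definition stable_operator : Prop :=
  forall Q (C : set (set T)) (g : T -> R),
    representation_set Q -> is_sub_sigma_algebra C ->
    is_cond_exp P C (density Q) g ->
    density_set (fun w => density Q w / g w).

Definition proper_operator : Prop :=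
  forall Q, representation_set Q -> Q `<< P /\ P `<< Q.

Definition optimal_solution xi (C : set (set T)) (eta : T -> R) : Prop :=
  LfunC P C (2 * p) eta /\
  ((rho (fun w => (xi w - eta w) ^+ 2))%:E =
    ereal_inf [set (rho (fun w => (xi w - eta' w) ^+ 2))%:E
              | eta' in LfunC P C (2 * p)])%E.

End convex_operators.

(* Main.v *)
Require Import Defs.
From mathcomp Require Import all_boot all_order all_algebra.
From mathcomp Require Import all_classical all_reals all_analysis.
From mathcomp Require Import measurable_realfun ring lra.

(** Uniqueness comes from strict convexity of the square, as soon as the
    supremum in the dual representation of [rho] is attained.

    Let [eta1], [eta2] be optimal with value [V], let [mid] be their midpoint
    and put [X1 = (xi - eta1)^2], [X2 = (xi - eta2)^2],
    [U = ((eta1 - eta2) / 2)^2], so that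
    [Y := (xi - mid)^2 = (X1 + X2) / 2 - U].  As [mid] is a competitor,
    [V <= rho Y].

    Weak compactness of the densities yields a measure [Q] at which the
    supremum defining [rho Y] is reached, which amounts to
    [rho Y <= E_Q[Y - z]] for every [z] with [rho z <= 0]
    ([worst_case_measure]).  By constant invariance [z = Xi - V] is such a
    [z] for [i = 1, 2]; averaging the two inequalities gives
    [V <= rho Y <= V - E_Q[U]].  Hence [U = 0] holds Q-a.s., and, [rho] being
    proper, P-a.s. ([midpoint_gap_eq0]).

    Attainment needs no semicontinuity of the penalty: near-optimality of a
    density is a family of inequalities indexed by the acceptable [z], each of
    which is linear and hence weakly closed ([weak_compact_near_optimal]). *)

Set Implicit Arguments.
Unset Strict Implicit.
Unset Printing Implicit Defensive.

Import Order.TTheory GRing.Theory Num.Theory.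
Import numFieldNormedType.Exports.

Local Open Scope classical_set_scope.
Local Open Scope ring_scope.

(** * Algebra of L^p functions *)

Section Lfun_algebra.
Context {d : measure_display} {T : measurableType d} {R : realType}.
Variable mu : {measure set T -> \bar R}.
Implicit Types f g : T -> R.

Lemma Lfun_measurable f (r : \bar R) : f \in Lfun mu r -> measurable_fun setT f.
Proof. by case/andP; rewrite inE. Qed.

Lemma Lfun_mul_Lfun1 f g (p q : R) : 0 < p -> 0 < q -> p^-1 + q^-1 = 1 ->
  f \in Lfun mu p%:E -> g \in Lfun mu q%:E -> f \* g \in Lfun mu 1%E.
Proof.
move=> p0 q0 pq fp gq.
have mf := Lfun_measurable fp; have mg := Lfun_measurable gq.
move: fp gq => /andP[_ /[!inE]/= nf] /andP[_ /[!inE]/= ng].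
apply/andP; split; rewrite inE/=; first exact: measurable_funM.
rewrite /finite_norm; apply: le_lt_trans (hoelder mu mf mg p0 q0 pq) _.
by rewrite lte_mul_pinfty// ?ge0_fin_numE ?Lnorm_ge0.
Qed.

Lemma Lfun_sqr f (p : R) : 1 <= p ->
  f \in Lfun mu (2 * p)%:E -> (fun w => f w ^+ 2) \in Lfun mu p%:E.
Proof.
move=> p1 f2p; have mf := Lfun_measurable f2p.
have p2 : 1 <= 2 * p by lra.
have /integrableP[_ fin] := Lfun_integrable p2 f2p.
apply/andP; split; rewrite inE/=; first exact: measurable_funX.
rewrite /finite_norm unlock /= poweR_lty//; apply: le_lt_trans fin.
rewrite le_eqVlt; apply/orP; left; apply/eqP; apply: eq_integral => x _ /=.
rewrite [X in _ = X%:E]ger0_norm ?powR_ge0// powRrM powR_mulrn//.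
by rewrite ger0_norm ?sqr_ge0// real_normK ?num_real.
Qed.

Lemma Lfun_linear_combination f g (r a b : R) : 1 <= r ->
  f \in Lfun mu r%:E -> g \in Lfun mu r%:E ->
  (fun w => a * f w + b * g w) \in Lfun mu r%:E.
Proof.
move=> r1 fr gr; have r1' : (1 <= r%:E)%E by rewrite lee_fin.
have [L0 LZD] := Lfun_submod_closed mu r1'.
have bg : b *: g \in Lfun mu r%:E by rewrite -[b *: g]addr0; exact: LZD.
exact: LZD.
Qed.

End Lfun_algebra.

(** * Change of measure *)

Section densities.
Context {d : measure_display} {T : measurableType d} {R : realType}.
Variables (P Q : probability T R).
Hypothesis QP : Q `<< P.

Lemma density_measurable : measurable_fun setT (density P Q).
Proof. exact: measurableT_comp. Qed.

Lemma EFin_density w : (density P Q w)%:E =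
  Radon_Nikodym (charge_of_finite_measure Q) P w.
Proof. by rewrite fineK// Radon_Nikodym_fin_num. Qed.

Lemma density_ge0 : {ae P, forall w, 0 <= density P Q w}.
Proof.
have := ae_eq_Radon_Nikodym_SigmaFinite QP (E := setT) measurableT.
apply: filterS => w /(_ I) dw; rewrite /density -dw.
by apply: fine_ge0; exact: Radon_Nikodym_SigmaFinite.f_ge0.
Qed.

(** Integrability under [Q] has to be derived before the change of variables
    can be applied to [Z] itself: it follows from the nonnegative case applied
    to [|Z|]. *)
Lemma integrable_density (Z : T -> R) : measurable_fun setT Z ->
  density P Q \* Z \in Lfun P 1%E -> Q.-integrable setT (EFin \o Z).
Proof.
move=> mZ /Lfun1_integrable /integrableP[_ fin].
apply/integrableP; split; first exact/measurable_EFinP.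
rewrite -(Radon_Nikodym_SigmaFinite.change_of_variables QP)//; last first.
  by apply: measurableT_comp => //; exact/measurable_EFinP.
apply: le_lt_trans fin; rewrite le_eqVlt; apply/orP; left; apply/eqP.
(* the two chosen versions of the Radon-Nikodym derivative agree P-a.e. *)
apply: ge0_ae_eq_integral => //.
- apply: emeasurable_funM.
    by apply: measurableT_comp => //; exact/measurable_EFinP.
  exact/measurable_int/Radon_Nikodym_SigmaFinite.f_integrable.
- apply: measurableT_comp => //; apply/measurable_EFinP.
  exact: measurable_funM density_measurable mZ.
- by move=> w _; rewrite mule_ge0// Radon_Nikodym_SigmaFinite.f_ge0.
have := ae_eq_Radon_Nikodym_SigmaFinite QP (E := setT) measurableT.
move=> /(filterI density_ge0); apply: filterS => w [d0 /(_ I) dw] _.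
by rewrite /= normrM (ger0_norm d0) EFinM EFin_density -dw muleC.
Qed.

Lemma expectation_density (Z : T -> R) : measurable_fun setT Z ->
  density P Q \* Z \in Lfun P 1%E -> ('E_Q[Z] = 'E_P[density P Q \* Z])%E.
Proof.
move=> mZ /(integrable_density mZ) iZ.
rewrite unlock -(Radon_Nikodym_change_of_variables QP measurableT iZ).
by apply: eq_integral => w _; rewrite -EFin_density /= -EFinM mulrC.
Qed.

End densities.

(** * Attainment of the dual supremum and strict convexity *)

Section attainment.
Context {d : measure_display} {T : measurableType d} {R : realType}.
Variables (P : probability T R) (p q : R) (rho : (T -> R) -> R).
Hypothesis D_compact : density_set_weak_compact P p q rho.

(** The sets of [e]-near-optimal densities form a filter base as [e] tends to
    0.  A cluster point of it in the compact set of densities satisfies every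
    limiting inequality, because each pairing is weakly continuous. *)
Lemma weak_compact_near_optimal (A : set (T -> R)) (c : R) :
  A `<=` [set z | z \in Lfun P p%:E] ->
  (forall e, 0 < e -> exists2 f, density_set P p q rho f &
     forall z, A z -> c - e <= fine ('E_P[f \* z])%E) ->
  exists2 f, density_set P p q rho f &
    forall z, A z -> c <= fine ('E_P[f \* z])%E.
Proof.
move=> AL near_opt.
pose S e : set (initial_topology (@duality_pairing _ _ _ P p q)) := [set h |
  density_set P p q rho (sval h) /\
  forall z, A z -> c - e <= fine ('E_P[sval h \* z])%E].
have S_filter : ProperFilter (filter_from [set e : R | 0 < e] S).
  apply: filter_from_proper; last first.
    move=> e /near_opt[f Df fA].
    by exists (exist _ f (proj1 Df)).
  apply: filter_from_filter; first by exists 1 => /=.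
  move=> e1 e2 /= e10 e20; exists (Num.min e1 e2); first by rewrite /= lt_min e10.
  by move=> h [Dh hA]; split; split=> // z /hA; apply: le_trans;
    rewrite lerD2l lerN2 ge_min lexx ?orbT.
have [|h [Dh clh]] := D_compact S_filter.
  by exists 1 => //= h [].
exists (sval h) => // z Az.
pose z' : {z : T -> R | z \in Lfun P p%:E} := exist _ z (AL _ Az).
rewrite leNgt; apply/negP => lt_c.
(* half the defect, so that the neighbourhood of [h] cut out by [c - e]
   misses the [e]-near-optimal densities *)
pose e := (c - fine ('E_P[sval h \* z])%E) / 2.
have e0 : 0 < e by rewrite /e; lra.
pose phi (k : initial_topology (@duality_pairing _ _ _ P p q)) : R :=
  fine ('E_P[sval k \* z])%E.
have phi_cont : {for h, continuous phi}.
  have c1 : {for h, continuous (@duality_pairing _ _ _ P p q :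
      initial_topology (@duality_pairing _ _ _ P p q) -> _)}.
    exact: initial_continuous.
  exact: continuous_comp c1 (@proj_continuous _ (fun _ => R) z' _).
have nb : nbhs h (phi @^-1` [set y : R | y < c - e]).
  apply: phi_cont; apply: open_nbhs_nbhs; split; first exact: open_lt.
  rewrite /= /phi /e; lra.
have [] := clh (S e) _ _ nb; first by exists e.
by move=> k [[_ /(_ _ Az) kz]] /=; rewrite ltNge kz.
Qed.

Hypotheses (p_gt1 : 1 < p) (pq : p^-1 + q^-1 = 1).

Let q_gt0 : 0 < q.
Proof.
rewrite -invr_gt0; have -> : q^-1 = 1 - p^-1 by rewrite -pq addrAC subrr add0r.
by rewrite subr_gt0 invf_lt1// (lt_trans _ p_gt1).
Qed.

(** By Hoelder's inequality between [Z] and the density, expectations of L^p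
    functions under measures of the representation set are finite, so that
    they can be added and subtracted freely. *)
Lemma representation_Lfun1 Q Z : representation_set P p q rho Q ->
  Z \in Lfun P p%:E -> Z \in Lfun Q 1%E.
Proof.
move=> [QP Qq _] Zp; apply/Lfun1_integrable/(integrable_density QP).
  exact: Lfun_measurable Zp.
apply: Lfun_mul_Lfun1 Qq Zp => //; last by rewrite addrC.
exact: lt_trans p_gt1.
Qed.

Lemma expectation_density_version Q f Z : representation_set P p q rho Q ->
  measurable_fun setT f -> f = density P Q %[ae P] -> Z \in Lfun P p%:E ->
  ('E_Q[Z] = 'E_P[f \* Z])%E.
Proof.
move=> [QP Qq _] mf fQ Zp; have mZ := Lfun_measurable Zp.
rewrite (expectation_density QP)//; last first.
  apply: Lfun_mul_Lfun1 Qq Zp => //; last by rewrite addrC.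
  exact: lt_trans p_gt1.
rewrite unlock; apply: ae_eq_integral => //.
- apply/measurable_EFinP; apply: measurable_funM => //.
  exact: density_measurable.
- by apply/measurable_EFinP; exact: measurable_funM.
by apply: filterS fQ => w /= fw /fw ->.
Qed.

(** The dual supremum is attained.  Ranging over the acceptance set, the
    inequalities together say that [E_Q[Y] - penalty Q >= rho Y], without any
    arithmetic on the extended real [penalty Q]. *)
Lemma worst_case_measure Y : dual_representation P p q rho ->
  Y \in Lfun P p%:E ->
  exists2 Q, representation_set P p q rho Q &
    forall z, acceptance_set P p rho z -> ((rho Y)%:E <= 'E_Q[Y \- z])%E.
Proof.
move=> dual Yp.
have Yz z : z \in Lfun P p%:E -> Y \- z \in Lfun P p%:E.
  move=> zp; have -> : Y \- z = (fun w => 1 * Y w + (-1) * z w).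
    by apply/funext => w /=; ring.
  exact: Lfun_linear_combination (ltW _) _ _.
have [|e e0|f [fq [Q Qrep fQ]] fopt] :=
    @weak_compact_near_optimal [set Y \- z | z in acceptance_set P p rho] (rho Y).
- by move=> _ [z [zp _] <-]; exact: Yz.
- have : ((rho Y - e)%:E < (rho Y)%:E)%E by rewrite lte_fin ltrBlDr ltrDl.
  rewrite (dual _ Yp) => /ereal_sup_gt[_ [Q Qrep <-] Qe].
  have [QP Qq _] := Qrep.
  have mQ := density_measurable QP.
  have versionE := expectation_density_version Qrep mQ (ae_eq_refl _ _ _).
  exists (density P Q); first by split=> //; exists Q => //; exact: ae_eq_refl.
  move=> _ [z [zp rz] <-].
  rewrite -versionE ?Yz// -lee_fin fineK; last first.
    exact/expectation_fin_num/(representation_Lfun1 Qrep)/Yz.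
  rewrite expectationB; [|exact: representation_Lfun1..].
  apply: le_trans (ltW Qe) _; apply: leeB => //.
  by apply: ereal_sup_ubound; exists z.
exists Q => // z zA; have [zp _] := zA.
have := fopt (Y \- z) (ex_intro2 _ _ z zA erefl).
rewrite -(expectation_density_version Qrep (Lfun_measurable fq) fQ) ?Yz//.
rewrite -lee_fin fineK//.
exact/expectation_fin_num/(representation_Lfun1 Qrep)/Yz.
Qed.

Lemma expectation_le0_ae_eq0 (Q : probability T R) U :
  U \in Lfun Q 1%E -> (forall w, 0 <= U w) -> ('E_Q[U] <= 0)%E ->
  U = cst 0 %[ae Q].
Proof.
move=> U1 U0 EU; have mU := Lfun_measurable U1.
have absU : (\int[Q]_w `|(EFin \o U) w| = 0)%E.
  apply/eqP; rewrite eq_le integral_ge0// andbT.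
  move: EU; rewrite unlock; apply: le_trans; rewrite le_eqVlt; apply/orP; left.
  by apply/eqP; apply: eq_integral => w _; rewrite /= ger0_norm.
have /measurable_EFinP mEU := mU.
have := (ae_eq_integral_abs Q measurableT mEU).1 absU.
by apply: filterS => w /= /[apply] -[].
Qed.

(** The strict convexity argument, with [U] in the role of the gap between a
    strictly convex function at a midpoint and the average of its values.  For
    a worst-case [Q] of the argument of [rho] on the right-hand side, both
    [Xi - rho Xi] are acceptable, and adding the two resulting inequalities
    leaves [E_Q[U] <= 0]. *)
Lemma midpoint_gap_eq0 X1 X2 U : convex_operator P p rho ->
  dual_representation P p q rho -> proper_operator P p q rho ->
  X1 \in Lfun P p%:E -> X2 \in Lfun P p%:E -> U \in Lfun P p%:E ->
  (forall w, 0 <= U w) ->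
  (rho X1 + rho X2) / 2 <= rho (fun w => (X1 w + X2 w) / 2 - U w) ->
  U = cst 0 %[ae P].
Proof.
move=> rho_convex dual proper X1p X2p Up U0; set Y := (fun w => _ - _) => gap.
have p1 := ltW p_gt1.
have Yp : Y \in Lfun P p%:E.
  have -> : Y = (fun w => 1 * (2^-1 * X1 w + 2^-1 * X2 w) + (-1) * U w).
    by apply/funext => w; rewrite /Y; field.
  apply: (Lfun_linear_combination _ _ p1 _ Up).
  exact: Lfun_linear_combination p1 X1p X2p.
have shift X : X \in Lfun P p%:E ->
    acceptance_set P p rho (fun w => X w + (- rho X)).
  move=> Xp; split; last by rewrite (co_constant rho_convex)// subrr.
  have -> : (fun w => X w - rho X) = (fun w => 1 * X w + (- rho X) * cst 1 w).
    by apply/funext => w /=; ring.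
  by apply: Lfun_linear_combination => //; exact: Lfun_cst.
have [Q Qrep Qopt] := worst_case_measure dual Yp.
have [_ PQ] := proper _ Qrep.
have LQ Z := representation_Lfun1 (Z := Z) Qrep.
suff /(null_dominates_ae_eq measurableT PQ) : U = cst 0 %[ae Q] by [].
have z1A := shift _ X1p; have z2A := shift _ X2p.
set z1 := (fun w => X1 w + _) in z1A.
set z2 := (fun w => X2 w + _) in z2A.
have Yz z : acceptance_set P p rho z -> Y \- z \in Lfun Q 1%E.
  move=> [zp _]; apply: LQ.
  have -> : Y \- z = (fun w => 1 * Y w + (-1) * z w).
    by apply/funext => w /=; ring.
  exact: Lfun_linear_combination p1 Yp zp.
apply: expectation_le0_ae_eq0 => //; first exact: LQ.
have := leeD (Qopt _ z1A) (Qopt _ z2A).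
rewrite -expectationD ?Yz//.
have -> : (Y \- z1) \+ (Y \- z2) = cst (rho X1 + rho X2) \- 2 \o* U.
  by apply/funext => w; rewrite /Y /z1 /z2 /=; field.
have U2 : 2 \o* U \in Lfun Q 1%E by apply: Lfun_scale => //; exact: LQ.
rewrite expectationB//; last exact: Lfun_cst.
rewrite expectation_cst expectationZl; last exact: LQ.
rewrite -(fineK (expectation_fin_num (LQ _ Up))).
rewrite -EFinD -EFinM -EFinB !lee_fin; lra.
Qed.

End attainment.

(** * Uniqueness of the optimal solution *)

Theorem theorem4p19 (d : measure_display) (T : measurableType d) (R : realType)
    (P : probability T R) (p q : R) (rho : (T -> R) -> R)
    (C : set (set T)) (xi : T -> R)
    (p_gt1 : 1 < p) (p_le2 : p <= 2) (pq : p^-1 + q^-1 = 1)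
    (rho_convex : convex_operator P p rho)
    (rho_dual : dual_representation P p q rho)
    (D_bounded : density_set_bounded P p q rho)
    (D_compact : density_set_weak_compact P p q rho)
    (P_convex : representation_set_convex P p q rho)
    (rho_stable : stable_operator P p q rho)
    (rho_proper : proper_operator P p q rho)
    (C_sub : is_sub_sigma_algebra C)
    (xi_L4p : xi \in Lfun P (4 * p)%:E) :
  forall eta1 eta2 : T -> R,
    optimal_solution P p rho xi C eta1 ->
    optimal_solution P p rho xi C eta2 ->
    eta1 = eta2 %[ae P].
Proof.
move=> eta1 eta2 [[eta1L eta1C] opt1] [[eta2L eta2C] opt2].
have p1 := ltW p_gt1; have p21 : 1 <= 2 * p by lra.
have xiL : xi \in Lfun P (2 * p)%:E.
  move: xi_L4p; apply: Lfun_subset.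
  - by rewrite lee_fin.
  - by rewrite lee_fin; lra.
  - exact: fin_num_measure.
  - by rewrite lee_fin; lra.
have diffL (f g : T -> R) : f \in Lfun P (2 * p)%:E ->
    g \in Lfun P (2 * p)%:E -> (fun w => f w - g w) \in Lfun P (2 * p)%:E.
  move=> fL gL.
  have -> : (fun w => f w - g w) = (fun w => 1 * f w + (-1) * g w).
    by apply/funext => w; ring.
  exact: Lfun_linear_combination p21 fL gL.
pose mid w := 2^-1 * eta1 w + 2^-1 * eta2 w.
have midLC : LfunC P C (2 * p) mid.
  split; first exact: Lfun_linear_combination p21 eta1L eta2L.
  by apply: measurable_funD; exact: measurable_funM.
have opt_mid : ((rho (fun w => (xi w - mid w) ^+ 2))%:E >=
    ereal_inf [set (rho (fun w => (xi w - eta' w) ^+ 2))%:E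
              | eta' in LfunC P C (2 * p)])%E.
  by apply: ereal_inf_lbound; exists mid.
pose U w := (2^-1 * (eta1 w - eta2 w)) ^+ 2.
suff : U = cst 0 %[ae P].
  apply: filterS => w /= /[apply] /eqP.
  by rewrite /U sqrf_eq0 mulf_eq0 invr_eq0 pnatr_eq0/= subr_eq0 => /eqP.
apply: (midpoint_gap_eq0 D_compact p_gt1 pq rho_convex rho_dual rho_proper
  (X1 := fun w => (xi w - eta1 w) ^+ 2) (X2 := fun w => (xi w - eta2 w) ^+ 2)).
- exact/Lfun_sqr/diffL.
- exact/Lfun_sqr/diffL.
- have -> : U = (fun w => (2^-1 * eta1 w + (- 2^-1) * eta2 w) ^+ 2).
    by apply/funext => w; rewrite /U mulrBr mulNr.
  exact/Lfun_sqr/Lfun_linear_combination.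
- by move=> w; exact: sqr_ge0.
have -> : (fun w => ((xi w - eta1 w) ^+ 2 + (xi w - eta2 w) ^+ 2) / 2 - U w)
    = (fun w => (xi w - mid w) ^+ 2).
  by apply/funext => w; rewrite /U /mid; field.
move: opt_mid (opt_mid); rewrite -{1}opt1 -opt2 !lee_fin; lra.
Qed.
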